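(* Let $G$ be a simple connected graph with $p$ vertices and $q$ edges, let $n$ be a positive integer, and let $t\in\{n-1,n\}$. Then $\varepsilon_R(S(G)_t^n)=\varepsilon_R(S(G))$.
   Context: The Randić matrix $R(G)$ of a graph $G$ has $(i,j)$ entry $1/\sqrt{d_id_j}$ if $v_i,v_j$ are adjacent ($d_i$ is the degree of $v_i$), and $0$ otherwise. The Randić energy $\varepsilon_R(G)$ is the sum of the absolute values of the eigenvalues of $R(G)$ (with multiplicity). The subdivision graph $S(G)$ is obtained by inserting a new vertex into every edge of $G$; its vertex set is identified with $V(G)\cup E(G)$, with $v\in V(G)$ adjacent to $e\in E(G)$ iff $v$ is an endpoint of $e$. $S(G)_t^n$ ($n$ a positive integer, $t=n$ or $t=n-1$): start with $S(G)$. For each $v_j\in V(G)$ introduce $n$ new isolated vertices and join each to all neighbors of $v_j$ in $S(G)$. Then, for each vertex $e_j\in E(G)$ of $S(G)$, introduce $t$ new isolated vertices and join each to all neighbors of $e_j$ in the graph obtained so far (including the newly added copies of vertices of $G$). It has $(n+1)p+(t+1)q$ vertices and $2(t+1)(n+1)q$ edges. *)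

(* Defs.v *)
From HB Require Import structures.
From mathcomp Require Import all_boot all_order all_algebra.
From mathcomp.real_closed Require Import complex.

Set Implicit Arguments.
Unset Strict Implicit.
Unset Printing Implicit Defensive.

Import Order.TTheory GRing.Theory Num.Theory.

Local Open Scope ring_scope.

Record sgraph := SGraph {
  vertex :> finType;
  adj : rel vertex;
  adj_sym : symmetric adj;
  adj_irr : irreflexive adj }.

Definition connected_sgraph (G : sgraph) : Prop :=
  (0 < #|G|)%N /\ forall x y : G, connect (@adj G) x y.

Definition degree (G : sgraph) (x : G) : nat := #|[set y | adj x y]|.

Definition edges (G : sgraph) : {set {set G}} :=
  [set e : {set G} | [exists x, exists y, adj x y && (e == [set x; y])]].

Definition edge (G : sgraph) : finType := {e : {set G} | e \in edges G}.

Section Subdivision.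
Variable G : sgraph.

Definition subdivision_adj : rel (G + edge G)%type := fun a b =>
  match a, b with
  | inl v, inr e | inr e, inl v => v \in val e
  | _, _ => false
  end.

Fact subdivision_adj_sym : symmetric subdivision_adj.
Proof. by case=> [x|e] [y|f]. Qed.

Fact subdivision_adj_irr : irreflexive subdivision_adj.
Proof. by case. Qed.

Definition subdivision : sgraph :=
  SGraph subdivision_adj_sym subdivision_adj_irr.

End Subdivision.

(* For every i : I, add k new pairwise nonadjacent vertices (i, 0), ...,       *)
(* (i, k-1), each joined to all the neighbours of the vertex f i in H.        *)
Section AddCopies.
Variables (H : sgraph) (I : finType) (f : I -> H) (k : nat).

Definition add_copies_adj : rel (H + I * 'I_k)%type := fun a b =>
  match a, b with
  | inl x, inl y => adj x y
  | inl x, inr (i, _) | inr (i, _), inl x => adj x (f i)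
  | inr _, inr _ => false
  end.

Fact add_copies_adj_sym : symmetric add_copies_adj.
Proof. by case=> [x|[i j]] [y|[i' j']] //=; apply: adj_sym. Qed.

Fact add_copies_adj_irr : irreflexive add_copies_adj.
Proof. by case=> [x|[i j]] //=; apply: adj_irr. Qed.

Definition add_copies : sgraph :=
  SGraph add_copies_adj_sym add_copies_adj_irr.

End AddCopies.

(* S(G) with n copies of each vertex coming from V(G). *)
Definition subdivision_copyV (G : sgraph) (n : nat) : sgraph :=
  @add_copies (subdivision G) G inl n.

(* S(G)_t^n *)
Definition subdivision_copy (G : sgraph) (n t : nat) : sgraph :=
  @add_copies (subdivision_copyV G n) (edge G) (fun e => inl (inr e)) t.

Definition randic_matrix (R : rcfType) (G : sgraph) : 'M[R]_#|G| :=
  \matrix_(i, j)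
    if adj (enum_val i) (enum_val j) then
      1 / Num.sqrt ((degree (enum_val i))%:R * (degree (enum_val j))%:R)
    else 0.

(* The complex eigenvalues with algebraic multiplicity: a list r such that     *)
(* char_poly A = \prod_(z <- r) ('X - z%:P), unique up to permutation.        *)
Definition eigenvalues (R : rcfType) (m : nat) (A : 'M[R]_m) : seq R[i] :=
  sval (closed_field_poly_normal (char_poly (map_mx (real_complex R) A))).

Definition randic_energy (R : rcfType) (G : sgraph) : R :=
  \sum_(z <- eigenvalues (randic_matrix R G)) ComplexField.Normc.normc z.

(* Main.v *)
Require Import Defs.
From mathcomp Require Import all_boot all_order all_algebra.
From mathcomp.real_closed Require Import complex.

(** Adding copies of vertices blows a graph up: there is a surjection f from
    the new graph H onto the old graph S, sending each copy to its original,
    such that two vertices of H are adjacent exactly when their images are.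
    Write m u for the number of vertices of H above u, and suppose that m is
    constant on the neighbourhood of each vertex of S.  Then, for adjacent x
    and y, the degree of x in H is m (f y) times the degree of f x in S, so
    the Randic weight of the edge xy is the weight of the edge (f x)(f y)
    divided by sqrt (m (f x) * m (f y)).  In matrix form (lemma
    [randic_matrix_blow_up]) this says R(H) = Q R(S) Q^T, where Q is the
    indicator matrix of f with column u scaled by 1 / sqrt (m u); the scaling
    makes the columns of Q orthonormal, Q^T Q = 1 ([fibre_isometryP]).

    Since A B and B A have the same eigenvalues up to zeros
    ([eigenvalues_mulmxC]), R(H) = Q (R(S) Q^T) has the same nonzero
    eigenvalues as R(S) Q^T Q = R(S).  Zeros contribute nothing to the energy,
    hence the energies agree.

    The hypothesis on m holds when k copies are given to all the vertices on
    one side of a bipartition: m is then k + 1 on that side and 1 on the other,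
    and every neighbourhood lies on a single side
    ([randic_energy_add_copies]).  The subdivision graph is bipartite with
    sides V(G) and E(G), and it remains bipartite after the vertices of G have
    been copied, so the construction consists of two such steps, each of which
    preserves the energy. *)

Set Implicit Arguments.
Unset Strict Implicit.
Unset Printing Implicit Defensive.

Import Order.TTheory GRing.Theory Num.Theory.

(** * Eigenvalues of A B and B A *)

Section Spectrum.
Local Open Scope ring_scope.

(** Sylvester's determinant identity: both sides are X^n times the determinant
    of the block matrix [X, A; B, 1], reduced to triangular form by clearing
    B from the right or from the left. *)
Lemma char_poly_mulmxC (K : comNzRingType) m n
    (A : 'M[K]_(m, n)) (B : 'M[K]_(n, m)) :
  'X^n * char_poly (A *m B) = 'X^m * char_poly (B *m A).
Proof.
rewrite /char_poly /char_poly_mx !map_mxM /=.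
set A' := map_mx polyC A; set B' := map_mx polyC B.
pose M := block_mx 'X%:M A' B' 1%:M.
have detM1 : \det M = \det ('X%:M - A' *m B').
  transitivity (\det (M *m block_mx 1%:M 0 (- B') 1%:M)).
    by rewrite det_mulmx det_lblock !det1 !mulr1.
  rewrite mulmx_block !mulmx1 !mulmx0 mulmxN mul1mx subrr add0r add0r.
  by rewrite det_ublock det1 mulr1.
have detM2 : 'X^n * \det M = 'X^m * \det ('X%:M - B' *m A').
  transitivity (\det (block_mx 1%:M 0 (- B') 'X%:M *m M)).
    by rewrite det_mulmx det_lblock det1 mul1r det_scalar.
  rewrite mulmx_block !mul1mx !mul0mx !addr0 mulmx1 mulNmx mulNmx.
  rewrite mul_mx_scalar mul_scalar_mx addNr.
  by rewrite det_ublock det_scalar addrC.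
by rewrite -detM1 detM2.
Qed.

Lemma eigenvaluesE (R : rcfType) m (A : 'M[R]_m) :
  char_poly (map_mx (real_complex R) A)
    = \prod_(z <- eigenvalues A) ('X - z%:P).
Proof.
rewrite /eigenvalues; case: closed_field_poly_normal => r /= {1}->.
by rewrite (monicP (char_poly_monic _)) scale1r.
Qed.

(** The zeros on either side match the powers of X in [char_poly_mulmxC]; two
    products of monic linear factors agree only if their roots do. *)
Lemma eigenvalues_mulmxC (R : rcfType) m n
    (A : 'M[R]_(m, n)) (B : 'M[R]_(n, m)) :
  perm_eq (nseq n 0 ++ eigenvalues (A *m B))
          (nseq m 0 ++ eigenvalues (B *m A)).
Proof.
have X_nseq k : 'X^k = \prod_(z <- nseq k 0) ('X - z%:P) :> {poly R[i]}.
  by rewrite big_nseq subr0 -Monoid.iteropE.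
apply: prod_XsubC_eq; rewrite !big_cat /= -!X_nseq -!eigenvaluesE !map_mxM.
by rewrite char_poly_mulmxC.
Qed.

Lemma sum_normc_eigenvalues_mulmxC (R : rcfType) m n
    (A : 'M[R]_(m, n)) (B : 'M[R]_(n, m)) :
  \sum_(z <- eigenvalues (A *m B)) ComplexField.Normc.normc z
    = \sum_(z <- eigenvalues (B *m A)) ComplexField.Normc.normc z.
Proof.
have sum_pad k (r : seq R[i]) : \sum_(z <- nseq k 0 ++ r)
    ComplexField.Normc.normc z = \sum_(z <- r) ComplexField.Normc.normc z.
  rewrite big_cat /= big1_seq ?add0r // => z /andP[_ /nseqP[-> _]].
  exact: ComplexField.Normc.normc0.
rewrite -(sum_pad n) -[RHS](sum_pad m).
exact: perm_big (eigenvalues_mulmxC A B).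
Qed.

End Spectrum.

(** * Blow-ups of a graph *)

Section BlowUp.
Local Open Scope ring_scope.
Variables (R : rcfType) (H S : sgraph) (f : H -> S).

Definition fibre_size (u : S) : nat := #|[set x | f x == u]|.

Hypothesis adj_f : forall x y, adj x y = adj (f x) (f y).
Hypothesis fibre_gt0 : forall u, (0 < fibre_size u)%N.
Hypothesis fibre_const :
  forall u v w, adj u v -> adj u w -> fibre_size v = fibre_size w.

(** The neighbours of x are the points above the neighbours of f x, and the
    fibres over these all have the size of the one over f y. *)
Lemma degree_blow_up x y :
  adj x y -> degree x = (degree (f x) * fibre_size (f y))%N.
Proof.
rewrite adj_f => xy; rewrite /degree -sum1dep_card.
rewrite (partition_big f (adj (f x))) /=; last by move=> z; rewrite -adj_f.
rewrite cardsE -sum_nat_const; apply: eq_bigr => u xu.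
rewrite -(fibre_const xu xy) /fibre_size -sum1dep_card.
by apply: eq_bigl => z; rewrite adj_f; case: eqP => [->|]; rewrite ?andbF ?andbT.
Qed.

(** The isometry that lifts a function on S to one on H constant on fibres,
    dividing by sqrt (m u) so that the norm is preserved. *)
Definition fibre_isometry : 'M[R]_(#|H|, #|S|) :=
  \matrix_(i, j) if f (enum_val i) == enum_val j
    then (Num.sqrt (fibre_size (enum_val j))%:R)^-1 else 0.
Local Notation Q := fibre_isometry.

Lemma mul_fibre_isometry n (A : 'M[R]_(#|S|, n)) i j :
  (Q *m A) i j = (Num.sqrt (fibre_size (f (enum_val i)))%:R)^-1
                   * A (enum_rank (f (enum_val i))) j.
Proof.
rewrite mxE (bigD1 (enum_rank (f (enum_val i)))) //= big1 ?addr0.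
  by rewrite mxE enum_rankK eqxx.
move=> k; rewrite mxE -(inj_eq enum_val_inj) enum_rankK eq_sym => /negPf->.
by rewrite mul0r.
Qed.

Lemma mulmx_tr_fibre_isometry n (A : 'M[R]_(n, #|S|)) i j :
  (A *m Q^T) i j = A i (enum_rank (f (enum_val j)))
                     * (Num.sqrt (fibre_size (f (enum_val j)))%:R)^-1.
Proof.
by rewrite -[A in LHS]trmxK -trmx_mul mxE mul_fibre_isometry mxE mulrC.
Qed.

Lemma fibre_isometryP : Q^T *m Q = 1%:M.
Proof.
apply/matrixP => i j; rewrite !mxE.
under eq_bigr => k _ do rewrite !mxE.
have [<-|ij] := eqVneq i j; last first.
  rewrite big1 // => k _; case: eqP => [->|_]; last by rewrite mul0r.
  by rewrite (inj_eq enum_val_inj) (negPf ij) mulr0.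
pose c : R := (Num.sqrt (fibre_size (enum_val i))%:R)^-1.
transitivity (\sum_(k in H) if f k == enum_val i then c * c else 0).
  rewrite [RHS]big_enum_val; apply: eq_bigr => k _.
  by case: eqP; rewrite ?mul0r.
rewrite -big_mkcondr sumr_const /c -invfM -expr2 sqr_sqrtr ?ler0n //.
have -> : #|[pred x in H | f x == enum_val i]| = fibre_size (enum_val i).
  by rewrite /fibre_size cardsE; apply: eq_card.
by rewrite -[LHS]mulr_natr mulVf // pnatr_eq0 -lt0n.
Qed.

(** By [degree_blow_up] the product of the degrees of two adjacent vertices
    x and y picks up the factor m (f y) * m (f x), which is symmetric in the two
    ends; its square root is exactly what the two scalings in Q contribute. *)
Lemma randic_matrix_blow_up :
  randic_matrix R H = Q *m (randic_matrix R S *m Q^T).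
Proof.
apply/matrixP => i j; rewrite mul_fibre_isometry.
rewrite mulmx_tr_fibre_isometry !mxE !enum_rankK -adj_f.
case: ifP => [ij|_]; last by rewrite mul0r mulr0.
have ji : adj (enum_val j) (enum_val i) by rewrite adj_sym.
rewrite (degree_blow_up ij) (degree_blow_up ji) !natrM !div1r -!invfM.
rewrite !sqrtrM ?mulr_ge0 ?ler0n //; congr (_ ^-1).
by rewrite mulrA mulrC; congr (_ * _); apply: mulrAC.
Qed.

Lemma randic_energy_blow_up : randic_energy R H = randic_energy R S.
Proof.
rewrite /randic_energy randic_matrix_blow_up sum_normc_eigenvalues_mulmxC.
by rewrite -mulmxA fibre_isometryP mulmx1.
Qed.

End BlowUp.

(** * Copying one side of a bipartition *)

Section Copies.
Local Open Scope ring_scope.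
Variables (R : rcfType) (H : sgraph) (I : finType) (f : I -> H) (k : nat).
Hypothesis f_inj : injective f.
Hypothesis f_side :
  forall u v, adj u v -> (u \in codom f) = (v \notin codom f).

Definition copy_source (x : add_copies f k) : H :=
  match x with inl u => u | inr (i, _) => f i end.

Lemma fibre_size_copy_source u :
  fibre_size copy_source u = (1 + (u \in codom f) * k)%N.
Proof.
rewrite /fibre_size -sum1dep_card big_mkcond big_sumType /=; congr (_ + _)%N.
  by rewrite -big_mkcond /= big_pred1_eq.
transitivity (\sum_(i : I) \sum_(a : 'I_k) (f i == u : nat))%N.
  rewrite pair_bigA /=; apply: eq_bigr => -[i a] _ /=.
  by case: eqP.
under eq_bigr => i _ do rewrite sum_nat_const card_ord mulnC.
have [/codomP[i ->]|fu] := boolP (u \in codom f).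
  rewrite (bigD1 i) //= eqxx big1 ?addn0 ?mul1n // => j ji.
  by rewrite (inj_eq f_inj) (negPf ji).
rewrite big1 // => i _; case: eqP => // fi.
by rewrite -fi codom_f in fu.
Qed.

(** Copies are pairwise nonadjacent, so [copy_source] reflects adjacency only
    because the image of f is independent; [f_side] gives this, and also that
    each neighbourhood lies either inside the image of f or outside it, where
    the size of the fibres is constant. *)
Lemma randic_energy_add_copies :
  randic_energy R (add_copies f k) = randic_energy R H.
Proof.
apply: (@randic_energy_blow_up R _ _ copy_source).
- case=> [x|[i a]] [y|[j b]] //=; first by rewrite adj_sym.
  by apply/esym/negP => /f_side; rewrite !codom_f.
- by move=> u; rewrite fibre_size_copy_source.
- move=> u v w /f_side uv /f_side uw; rewrite !fibre_size_copy_source.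
  by rewrite -[v \in _]negbK -uv uw negbK.
Qed.

End Copies.

(** * Subdivision graphs *)

Theorem theorem3p10 (R : rcfType) (G : sgraph) (p q n t : nat)
    (hG : connected_sgraph G) (hp : #|G| = p) (hq : #|edges G| = q)
    (hn : (0 < n)%N) (ht : t = n.-1 \/ t = n) :
  randic_energy R (subdivision_copy G n t) = randic_energy R (subdivision G).
Proof.
have inVE v : (inl v \in codom (inl : G -> subdivision G)).
  exact: codom_f.
have notinVE e : (inr e \notin codom (inl : G -> subdivision G)).
  by apply/negP => /codomP[].
(* The last copying step comes off first: it copies the side of the edges of
   G, in the graph where the vertices of G already have their copies. *)
rewrite /subdivision_copy randic_energy_add_copies.
- rewrite /subdivision_copyV randic_energy_add_copies //.
    by move=> u v [].
  by case=> [u|e] [v|e'] //= _; rewrite ?inVE (negPf (notinVE _)).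
- by move=> e e' [].
pose g (e : edge G) : subdivision_copyV G n := inl (inr e).
have inE e : g e \in codom g by exact: codom_f.
have notinV v : inl (inl v) \notin codom g by apply/negP => /codomP[].
have notinC c : inr c \notin codom g by apply/negP => /codomP[].
by case=> [[u|e]|[u a]] [[v|e']|[v b]] //= _;
  rewrite ?inE ?(negPf (notinV _)) ?(negPf (notinC _)).
Qed.
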